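(* Let $\mathcal{A}=\langle A,R\rangle$ be a countable, almost bounded structure. Then $\mathcal{A}^*\cong\mathcal{A}^{\mathfrak{ue}}$ for any regular ultrapower $\mathcal{A}^*=\langle A^*,R^*\rangle$ of $\mathcal{A}$ with cardinality $|A^*|=|\mathrm{Uf}(A)|$.
   Context: All structures are of the form $\mathcal{A}=\langle A,R\rangle$ with a single binary relation $R\subseteq A\times A$. $\mathcal{A}$ is bounded if there is a finite number that bounds the in-degree and out-degree of every node of $\mathcal{A}$. $\mathcal{A}$ is almost bounded if, except for finitely many nodes with infinite degree (infinitely many $R$-successors or infinitely many $R$-predecessors), $\mathcal{A}$ is bounded; i.e. only finitely many nodes have infinite degree and there is a finite bound on the in- and out-degrees of all the other nodes. The ultrafilter extension of $\mathcal{A}$ is $\mathcal{A}^{\mathfrak{ue}}=\langle \mathrm{Uf}(A),R^{\mathfrak{ue}}\rangle$, where $\mathrm{Uf}(A)$ is the set of all ultrafilters over $A$ and $R^{\mathfrak{ue}}(u,v)$ holds iff $\{R[X]:X\in u\}\subseteq v$ (equivalently $\{\langle R\rangle(X):X\in v\}\subseteq u$), with $R[X]=\{s:(\exists w\in X)\,R(w,s)\}$ and $\langle R\rangle(X)=\{w:(\exists s\in X)\,R(w,s)\}$. An ultrafilter $\mathcal{D}$ over an infinite set $I$ is regular if there is $E\subseteq\mathcal{D}$ with $|E|=|I|$ such that each $i\in I$ belongs to only finitely many members of $E$; a regular ultrapower is an ultrapower modulo a regular ultrafilter. *)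

(* Defs.v *)
From mathcomp Require Import all_boot.
From mathcomp Require Import boolp classical_sets functions cardinality filter.

Set Implicit Arguments.
Unset Strict Implicit.
Unset Printing Implicit Defensive.

Local Open Scope classical_set_scope.
Local Open Scope card_scope.

(* Structures may be empty or finite; [countable] below means cardinality at
   most that of [nat]. *)
Record structure := Structure {
  carrier :> Type;
  edge : carrier -> carrier -> Prop
}.

Definition isomorphic (S T : structure) : Prop :=
  exists f : S -> T, bijective f /\ forall x y, edge x y <-> edge (f x) (f y).

Definition successors (S : structure) (x : S) : set S := [set y | edge x y].
Definition predecessors (S : structure) (x : S) : set S := [set y | edge y x].

Definition infinite_degree (S : structure) (x : S) : Prop :=
  infinite_set (successors x) \/ infinite_set (predecessors x).

Definition degrees_le (S : structure) (n : nat) (x : S) : Prop :=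
  successors x #<= `I_n /\ predecessors x #<= `I_n.

(* Degrees are computed in the whole structure: edges to and from the nodes of
   infinite degree are counted. *)
Definition almost_bounded (S : structure) : Prop :=
  finite_set [set x : S | infinite_degree x] /\
  exists n : nat, forall x : S, ~ infinite_degree x -> degrees_le n x.

Definition ultrafilter (T : Type) : Type := {u : set_system T | UltraFilter u}.

Definition edge_image (S : structure) (X : set S) : set S :=
  [set y | exists2 x, X x & edge x y].

Definition ue_edge (S : structure) (u v : ultrafilter S) : Prop :=
  forall X : set S, sval u X -> sval v (edge_image X).

Definition ultrafilter_extension (S : structure) : structure :=
  Structure (@ue_edge S).

Definition regular_ultrafilter (I : Type) (D : set_system I) : Prop :=
  [/\ infinite_set [set: I], UltraFilter D &
      exists E : set (set I), [/\ E `<=` D, E #= [set: I] &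
        forall i : I, finite_set [set X | E X /\ X i]]].

(* The quotient of [I -> T] by almost-everywhere equality is encoded as the
   type of equivalence classes; this is a partition when [D] is a filter. *)
Definition ae_class (I T : Type) (D : set_system I) (f : I -> T)
  : set (I -> T) := [set g | D [set i | f i = g i]].

Definition ultrapower_carrier (I T : Type) (D : set_system I) : Type :=
  {C : set (I -> T) | exists f, C = ae_class D f}.

Definition ultrapower_edge (S : structure) (I : Type) (D : set_system I)
    (C C' : ultrapower_carrier S D) : Prop :=
  exists f g, [/\ sval C f, sval C' g & D [set i | edge (f i) (g i)]].

Definition ultrapower (S : structure) (I : Type) (D : set_system I)
  : structure := Structure (@ultrapower_edge S I D).

(* Main.v *)
Require Import Defs.
From mathcomp Require Import all_boot.
From mathcomp Require Import boolp classical_sets functions cardinality filter.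

Set Implicit Arguments.
Unset Strict Implicit.
Unset Printing Implicit Defensive.

Local Open Scope classical_set_scope.
Local Open Scope card_scope.

(** The ultrapower and the ultrafilter extension of [A] are two instances of
    one notion, called an extension of the set [A]: a set [X] of points, each
    carrying an ultrafilter over [A], on which every function [A -> A] acts,
    together with a copy of [A] consisting of the points whose ultrafilter is
    principal.  Everything is done for extensions.

    Almost boundedness makes the edge relation a finite union of graphs of
    functions and converses of such graphs, each function being either an
    involution or a constant with an infinite-degree node as its value
    ([almost_bounded_cover]): colour the other nodes with finitely many colours
    so that distinct neighbours of a node get distinct colours, and match
    neighbours with prescribed colours.  Because an ultrafilter that contains a
    finite union contains one of its members, the edges of both extensions are
    determined by how these functions act and by the ultrafilters of the points
    ([ultrapower_edge_lifted], [ue_edge_lifted]).  It is thus enough to find a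
    bijection between the two extensions that is the identity on the copies of
    [A], commutes with the involutions and preserves finitely many predicates.

    The words in the involutions act on an extension by bijections.  The type of
    a point records which predicates hold along its orbit and which words fix
    it; all this is read off from countably many membership questions to the
    ultrafilter of the point.  Two points of the same type have isomorphic
    orbits.  If a non-standard point has type [p], then [p] is approximated by a
    decreasing sequence of infinite subsets of [A] with empty intersection, and
    in both extensions [p] is realized by as many points in pairwise distinct
    orbits as the extension has points ([ultrapower_rich], [ue_rich]).  Both
    times, the tool is a sequence [t] whose members are not related by short
    words ([sparse_sequence]).  In the ultrapower, take such a sequence [t_n] in
    the [n]-th approximation for each [n], number the elements of [A], and send
    the class of [f] to the class of [i |-> t_(nu i) (f i)], where regularity
    provides [nu] with infinite limit along the ultrafilter.  In the ultrafilter
    extension, pick the [m]-th member of [t] in the [m]-th approximation, and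
    push forward along [t] the tensor product of a given ultrafilter with a
    fixed non-principal one.

    As the two extensions have the same cardinality, each then embeds
    equivariantly in the other ([equivariant_embedding]).  The range of an
    equivariant map is a union of orbits, so that the bijection produced by the
    Schroeder-Bernstein argument is again equivariant
    ([mutual_morphisms_bijective]); no orbits need to be counted. *)

(** * Ultrafilters *)

Lemma filter_meet (T : Type) (F : set_system T) (S S' : set T) :
  ProperFilter F -> F S -> F S' -> exists x, S x /\ S' x.
Proof. by move=> FP FS FS'; apply: filter_ex (filterI FS FS'). Qed.

Lemma ultra_setC (T : Type) (F : set_system T) (S : set T) :
  UltraFilter F -> F (~` S) <-> ~ F S.
Proof.
move=> FU; split; last by case: (in_ultra_setVsetC S FU).
by move=> FnS FS; have [x []] := filter_meet (@ultra_proper _ _ FU) FS FnS.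
Qed.

Lemma build_ultra (T : Type) (F : set_system T) :
  ProperFilter F -> (forall S, F S \/ F (~` S)) -> UltraFilter F.
Proof.
move=> FP FVC; split=> // G GP FG; rewrite eqEsubset; split=> // S GS.
case: (FVC S) => // /FG GnS.
by have [x []] := filter_meet GP GS GnS.
Qed.

Lemma ultra_exists (T : Type) (K : finType) (F : set_system T) (P : K -> set T) :
  UltraFilter F -> F [set x | exists k, P k x] -> exists k, F (P k).
Proof.
move=> FU FP; apply: contrapT => nP.
have FnP : F [set x | forall k, ~ P k x].
  apply: (@filter_forall T K (fun k => ~` P k)) => k.
  by apply/ultra_setC => FPk; apply: nP; exists k.
by have [x [[k Pkx] /(_ k)]] := filter_meet (@ultra_proper _ _ FU) FP FnP.
Qed.

Lemma ultra_sub_eq (T : Type) (F G : set_system T) :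
  UltraFilter F -> UltraFilter G -> F `<=` G -> F = G.
Proof. by move=> FU GU FG; rewrite (@max_filter _ F FU G). Qed.

Lemma ultra_neq (T : Type) (F G : set_system T) :
  UltraFilter F -> UltraFilter G -> F <> G -> exists2 S, F S & ~ G S.
Proof.
move=> FU GU nFG; apply: contrapT => nS; apply: nFG.
apply: ultra_sub_eq => S FS; apply: contrapT => nGS.
by apply: nS; exists S.
Qed.

Lemma ultra_fmap (T U : Type) (f : T -> U) (F : set_system T) :
  UltraFilter F -> UltraFilter (f @ F).
Proof.
move=> FU; apply: build_ultra => S.
exact: (in_ultra_setVsetC (f @^-1` S) FU).
Qed.

(** * Finite covers and greedy colourings *)

(** Infinity, in the form in which it is used: choosing a point that avoids
    finitely many given ones. *)
Definition inexhaustible (T : Type) (S : set T) : Prop :=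
  forall (K : finType) (v : K -> T), exists2 x, S x & forall k, x <> v k.

Lemma nonprincipal_inexhaustible (T : Type) (F : set_system T) (S : set T) :
  UltraFilter F -> (forall x, ~ F [set x]) -> F S -> inexhaustible S.
Proof.
move=> FU nF FS K v; apply: contrapT => nS.
have [k Fk] : exists k, F [set v k].
  apply: (ultra_exists FU); apply: filterS FS => x Sx.
  apply: contrapT => nx; apply: nS; exists x => // k xk.
  by apply: nx; exists k.
exact: nF Fk.
Qed.

(** Domain and codomain being possibly empty, the injection is defined only on
    [S]. *)
Lemma card_le_inj (T U : Type) (S : set T) (B : set U) : S #<= B ->
  exists f : forall x, S x -> U, (forall x Sx, B (f x Sx)) /\
    (forall x Sx y Sy, f x Sx = f y Sy -> x = y).
Proof.
case/card_leP=> f.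
exists (fun x Sx => val (f (SigSub (mem_set Sx)))); split.
  by move=> x Sx; apply: set_valP.
move=> x Sx y Sy /val_inj /(@inj _ _ _ f) H.
by have [] := H (mem_set I) (mem_set I).
Qed.

Lemma card_leTT_inj (T U : Type) : [set: T] #<= [set: U] ->
  exists f : T -> U, injective f.
Proof.
by case/card_le_inj=> f [_ finj]; exists (f^~ Logic.I) => x y /finj.
Qed.

Lemma card_le_cover (T : Type) (S : set T) n (x0 : T) : S #<= `I_n ->
  exists v : 'I_n -> T, forall x, S x -> exists k, x = v k.
Proof.
case/card_le_inj=> f [fn finj].
have /choice [v vP] : forall k : 'I_n, exists y,
    forall x (Sx : S x), f x Sx = k -> x = y.
  move=> k; have [[x [Sx fx]]|nx] := pselect (exists x (Sx : S x), f x Sx = k).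
    by exists x => y Sy fy; apply: (finj _ Sy _ Sx); rewrite fx.
  by exists x0 => x Sx fx; case: nx; exists x, Sx.
exists v => x Sx; exists (Ordinal (fn x Sx)).
exact: (vP (Ordinal (fn x Sx)) x Sx).
Qed.

Lemma finite_set_cover (T : Type) (S : set T) : finite_set S ->
  exists (K : finType) (v : K -> T), forall x, S x -> exists k, x = v k.
Proof.
case=> n Sn; have [[x0 _]|S0] := pselect (S !=set0); last first.
  by exists void, (fun k : void => match k with end) => x Sx; case: S0; exists x.
have [|v vP] := @card_le_cover T S n x0; last by exists 'I_n, v.
by move: Sn; rewrite card_eq_le => /andP[].
Qed.

(** Colour the points in the order given by [iota]; when [x] is reached, at most
    [#|K|] colours have been given to the points [v k x], so one more colour
    suffices.  Only conflicts seen from both endpoints are avoided, since the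
    endpoint that comes last has to see the other one. *)
Lemma greedy_coloring (T : Type) (K : finType) (iota : T -> nat)
    (v : K -> T -> T) : injective iota ->
  exists col : T -> 'I_#|K|.+1, forall x y, x <> y ->
    (exists k, y = v k x) -> (exists k, x = v k y) -> col x <> col y.
Proof.
move=> iota_inj.
pose used (c : T -> 'I_#|K|.+1) x := [set c (v k x) | k : K]%SET.
pose free c x := odflt ord0 [pick i | i \notin used c x].
have freeP c x : free c x \notin used c x.
  rewrite /free; case: pickP => //= all_used.
  suff : #|K| < #|used c x| by rewrite ltnNge leq_imset_card.
  rewrite (_ : used c x = [set: 'I_#|K|.+1]%SET) ?cardsT ?card_ord //.
  by apply/setP => i; rewrite !inE; apply/negbNE; rewrite all_used.
(* [stage m] is correct on the points with index below [m]. *)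
pose stage := fix stage m := if m is m'.+1 then
  fun x => if iota x == m' then free (stage m') x else stage m' x
  else fun=> ord0.
have stageE m x : iota x < m -> stage m x = free (stage (iota x)) x.
  elim: m => // m IH; rewrite ltnS leq_eqVlt => /orP[/eqP <-|lt] /=.
    by rewrite eqxx.
  by rewrite ltn_eqF // IH.
pose col x := stage (iota x).+1 x.
exists col.
suff half x y : iota y < iota x -> (exists k, y = v k x) -> col x <> col y.
  move=> x y nxy xy yx.
  have [lt|lt|/iota_inj //] := ltngtP (iota x) (iota y); last exact: half.
  by move/esym; apply: half.
move=> lt [k def_y] eq_col; have /negP := freeP (stage (iota x)) x; apply.
rewrite -(@stageE (iota x).+1) // -/(col x) eq_col /col stageE //.
rewrite -(stageE (iota x)) //.
by rewrite def_y imset_f.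
Qed.

(** Three colours are enough to separate every [x] from [g x] when these differ.
    One colour class belongs to [F], hence so does its preimage by [g], and on
    their intersection [g] can only be the identity. *)
Lemma ultra_fixpoint (T : Type) (F : set_system T) (g : T -> T) :
  countable [set: T] -> injective g -> UltraFilter F -> g @ F = F ->
  F [set x | g x = x].
Proof.
move=> /card_leTT_inj [iota iota_inj] g_inj FU gF.
have /choice [h hP] : forall y, exists x, forall z, g z = y -> z = x.
  move=> y; have [[x gx]|ny] := pselect (exists x, g x = y).
    by exists x => z gz; apply: g_inj; rewrite gx.
  by exists y => z gz; case: ny; exists z.
have [col colP] := greedy_coloring (fun b : bool => if b then g else h) iota_inj.
have [c Fc] : exists c, F [set x | col x = c].
  by apply: (ultra_exists FU); apply: filterS filterT => x _; exists (col x).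
have Fgc : F [set x | col (g x) = c] by rewrite -gF in Fc.
apply: filterS (filterI Fc Fgc) => x [/= cx cgx]; apply: contrapT => ngx.
apply: (colP x (g x)); rewrite ?cx ?cgx //; first by move/esym.
  by exists true.
by exists false; apply: hP.
Qed.

(** * Extensions of a set *)

(** [uf x] plays the role of the set of properties of [x]; [lift_fix] and
    [fix_lift] let it decide whether [x] is fixed by an injective [f]. *)
Record extension (A : Type) := Extension {
  point :> Type;
  uf : point -> set_system A;
  lift : (A -> A) -> point -> point;
  std : A -> point;
  uf_ultra : forall x, UltraFilter (uf x);
  uf_lift : forall f x S, uf (lift f x) S <-> uf x (f @^-1` S);
  lift_comp : forall f g x, lift f (lift g x) = lift (f \o g) x;
  lift_fix : forall f x, uf x [set a | f a = a] -> lift f x = x;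
  fix_lift : forall f x, injective f -> lift f x = x -> uf x [set a | f a = a];
  lift_cst : forall a x, lift (fun=> a) x = std a;
  uf_std : forall a, uf (std a) [set a]
}.

Arguments std {A} X _ : rename.

Section ExtensionTheory.
Variables (A : Type) (X : extension A).
Implicit Types (x y : X) (a : A).

Lemma uf_filter x : ProperFilter (uf x).
Proof. by have := uf_ultra x; case. Qed.

Lemma lift_eqid f x : (forall a, f a = a) -> lift f x = x.
Proof.
move=> fK; apply: lift_fix; apply: (@filterS _ _ (uf_filter x) setT).
  by move=> a _; apply: fK.
exact: (@filterT _ _ (uf_filter x)).
Qed.

Lemma uf_stdP x a : uf x [set a] -> x = std X a.
Proof.
move=> xa; rewrite -(lift_cst a x); apply/esym/lift_fix.
by apply: (@filterS _ _ (uf_filter x)) xa => b ->.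
Qed.

Lemma lift_std f a : lift f (std X a) = std X (f a).
Proof. by rewrite -(lift_cst a (std X a)) lift_comp lift_cst. Qed.

Lemma std_inj : injective (std X).
Proof.
move=> a b ab; have := uf_std X b; rewrite -ab => Fb.
have [c [ca cb]] := filter_meet (uf_filter (std X a)) (uf_std X a) Fb.
by rewrite -(ca : c = a) -(cb : c = b).
Qed.

Definition nonstd x := forall a, x <> std X a.

Lemma nonstd_uf x : nonstd x -> forall a, ~ uf x [set a].
Proof. by move=> nx a /uf_stdP /nx. Qed.

Lemma std_or_nonstd x : (exists a, x = std X a) \/ nonstd x.
Proof.
have [|nx] := pselect (exists a, x = std X a); first by left.
by right=> a xa; apply: nx; exists a.
Qed.

End ExtensionTheory.

(** * The action of words in involutions *)

Section Words.
Variables (A : Type) (K : finType) (s : K -> A -> A).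
Hypothesis sK : forall k, involutive (s k).

Definition act (w : seq K) (a : A) : A := foldr s a w.

Lemma act_cat w w' a : act (w ++ w') a = act w (act w' a).
Proof. exact: foldr_cat. Qed.

Lemma act_rev w a : act (rev w) (act w a) = a.
Proof. by elim: w => //= k w IH; rewrite rev_cons -cats1 act_cat /= sK. Qed.

Lemma act_inj w : injective (act w).
Proof. exact: can_inj (act_rev w). Qed.

Variable X : extension A.
Implicit Types x y : X.

Definition wlift w x : X := lift (act w) x.

Lemma wlift_cat w w' x : wlift (w ++ w') x = wlift w (wlift w' x).
Proof.
by rewrite /wlift lift_comp; congr lift; apply/funext => a; apply: act_cat.
Qed.

Lemma wlift1 k x : wlift [:: k] x = lift (s k) x.
Proof. by []. Qed.

Lemma wlift_rev w x : wlift (rev w) (wlift w x) = x.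
Proof. by rewrite /wlift lift_comp; apply: lift_eqid; apply: act_rev. Qed.

Lemma wlift_revr w x : wlift w (wlift (rev w) x) = x.
Proof. by rewrite -{1}(revK w) wlift_rev. Qed.

Lemma wlift_std w a : wlift w (std X a) = std X (act w a).
Proof. exact: lift_std. Qed.

Lemma nonstd_wlift w x : nonstd x -> nonstd (wlift w x).
Proof.
by move=> nx a wx; apply: (nx (act (rev w) a)); rewrite -wlift_std -wx wlift_rev.
Qed.

Lemma wlift_fix w x : wlift w x = x <-> uf x [set a | act w a = a].
Proof.
by split; [apply: fix_lift; apply: act_inj|apply: lift_fix].
Qed.

Definition orbit x : set X := [set y | exists w, y = wlift w x].

Lemma orbit_wlift w x : orbit (wlift w x) = orbit x.
Proof.
rewrite eqEsubset; split=> y [v ->]; first by exists (v ++ w); rewrite wlift_cat.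
by exists (v ++ rev w); rewrite wlift_cat wlift_rev.
Qed.

(** Saturation and a count of orbits in one: instead of the number of orbits that
    meet all [S n], a family of such orbits indexed by the whole extension. *)
Definition rich : Prop :=
  forall S : nat -> set A, (forall n, inexhaustible (S n)) ->
    (forall m n, m <= n -> S n `<=` S m) ->
  exists d : X -> X, (forall x n, uf (d x) (S n)) /\
    forall w x y, wlift w (d x) = d y -> x = y.

End Words.

(** * Types and the equivariant embedding *)

Section Embedding.
Variables (A : Type) (iota : A -> nat).
Hypothesis iota_inj : injective iota.
Variables (K : finType) (s : K -> A -> A).
Hypothesis sK : forall k, involutive (s k).
Variables (L : countType) (P : L -> set A).

Notation act := (act s).
Notation wlift := (wlift s).

(** A probe [(w, b)] asks, after moving by the word [w], whether the point is
    fixed by a word ([b] on the left) or satisfies a predicate ([b] on the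
    right).  The set of probes with a positive answer determines the orbit up to
    isomorphism. *)
Definition probe : countType := (seq K * (seq K + L))%type.

Definition probe_set (b : seq K + L) : set A :=
  match b with inl v => [set a | act v a = a] | inr l => P l end.

Definition type_of (X : extension A) (x : X) : set probe :=
  [set p | uf x (act p.1 @^-1` probe_set p.2)].

Definition shift (v : seq K) (p : set probe) : set probe :=
  [set q | p (q.1 ++ v, q.2)].

Lemma type_of_wlift (X : extension A) w (x : X) :
  type_of (wlift w x) = shift w (type_of x).
Proof.
rewrite predeqE => -[v b]; rewrite /type_of /shift /wlift /= uf_lift.
by rewrite (_ : act (v ++ w) = act v \o act w) //; apply/funext => a; apply: act_cat.
Qed.

Lemma type_of_fix (X : extension A) w (x : X) :
  type_of x ([::], inl w) <-> wlift w x = x.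
Proof. by rewrite wlift_fix. Qed.

Lemma type_of_pred (X : extension A) l (x : X) :
  type_of x ([::], inr l) <-> uf x (P l).
Proof. by []. Qed.

(** The condition [n <= iota a] makes the intersection over [n] empty, so that
    whatever realizes all approximations is non-standard. *)
Definition approx (p : set probe) (n : nat) : set A :=
  [set a | n <= iota a /\ forall q : probe, pickle q < n ->
     (p q <-> probe_set q.2 (act q.1 a))].

Lemma approx_decr p m n : m <= n -> approx p n `<=` approx p m.
Proof.
move=> mn a [na pa]; split; first exact: leq_trans mn na.
by move=> q qm; apply: pa; apply: leq_trans mn.
Qed.

Lemma uf_approx (X : extension A) (x : X) n : nonstd x ->
  uf x (approx (type_of x) n).
Proof.
move=> nx; have FF := uf_filter x; elim: n => [|n IH].
  by apply: filterS filterT => a _; split.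
have Fn : uf x [set a | iota a <> n].
  have [Fn|//] := in_ultra_setVsetC [set a | iota a = n] (uf_ultra x).
  have [a [an _]] := filter_meet FF Fn Fn.
  case: (nonstd_uf nx (a := a)); apply: filterS Fn => b bn.
  by apply: iota_inj; rewrite [LHS]bn.
have Fq : uf x [set a | forall q : probe, pickle q = n ->
     (type_of x q <-> probe_set q.2 (act q.1 a))].
  have [[q qn]|nq] := pselect (exists q : probe, pickle q = n); last first.
    by apply: filterS filterT => a _ q qn; case: nq; exists q.
  have uniq_q q' : pickle q' = n -> q' = q.
    by move=> q'n; apply: (pcan_inj (@pickleK probe)); rewrite q'n.
  have [xq|nxq] := pselect (type_of x q).
    by apply: filterS (xq) => a Pa q' /uniq_q ->.
  have : uf x (~` (act q.1 @^-1` probe_set q.2)).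
    exact/(@ultra_setC _ _ _ (uf_ultra x)).
  by apply: filterS => a nPa q' /uniq_q ->.
apply: filterS (filterI IH (filterI Fn Fq)) => a [[na pa] [an qa]]; split.
  by rewrite ltn_neqAle na andbT; apply/eqP => ?; apply: an.
by move=> q; rewrite ltnS leq_eqVlt => /orP[/eqP /qa|/pa].
Qed.

Lemma type_of_approx (X : extension A) (x : X) p :
  (forall n, uf x (approx p n)) -> type_of x = p.
Proof.
move=> xp; have FF := uf_filter x; rewrite predeqE => q; split.
  move=> xq; have [a [Pa [_ pa]]] := filter_meet FF xq (xp (pickle q).+1).
  exact/pa.
by move=> pq; apply: filterS (xp (pickle q).+1) => a [_ pa]; apply/pa.
Qed.

Lemma nonstd_approx (X : extension A) (x : X) p :
  (forall n, uf x (approx p n)) -> nonstd x.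
Proof.
move=> xp a xa; have := xp (iota a).+1; rewrite xa => Fa.
have [b [-> []]] := filter_meet (uf_filter (std X a)) (uf_std X a) Fa.
by rewrite ltnn.
Qed.

Definition morphism (X Y : extension A) (e : X -> Y) : Prop :=
  [/\ forall a, e (std X a) = std Y a,
      forall k x, e (lift (s k) x) = lift (s k) (e x) &
      forall l x, uf (e x) (P l) <-> uf x (P l)].

(** The type of a non-standard point has infinite approximations, because the
    ultrafilter of the point contains them and is not principal. *)
Lemma independent_realizations (Y : extension A) : rich s Y ->
  exists d : set probe -> Y -> Y, forall (X : extension A) (x : X), nonstd x ->
    [/\ forall y, nonstd (d (type_of x) y),
        forall y, type_of (d (type_of x) y) = type_of x &
        forall w y y', wlift w (d (type_of x) y) = d (type_of x) y' -> y = y'].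
Proof.
move=> richY.
have /choice [d dP] : forall p, exists d : Y -> Y,
    (forall n, inexhaustible (approx p n)) ->
    (forall y n, uf (d y) (approx p n)) /\
    forall w y y', wlift w (d y) = d y' -> y = y'.
  move=> p; have [ip|nip] := pselect (forall n, inexhaustible (approx p n)).
    by have [d dP] := richY _ ip (@approx_decr p); exists d.
  by exists id.
exists d => X x nx.
have [|d1 d2] := dP (type_of x).
  move=> n; apply: nonprincipal_inexhaustible (uf_approx n nx).
    exact: uf_ultra.
  exact: nonstd_uf.
split=> [y|y|//].
  exact: (nonstd_approx (d1 y)).
exact: type_of_approx (d1 y).
Qed.

(** The embedding must send distinct orbits to distinct orbits, even when they
    are isomorphic.  For this, isomorphic orbits need roots of one and the
    same type; it is chosen from the set of types that occur in the orbit, a set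
    that isomorphic orbits share. *)
Lemma canonical_roots (X : extension A) : exists r : X -> X,
  [/\ forall x, orbit s x (r x), forall w x, r (wlift w x) = r x &
      forall x y,
        (forall v, exists v', type_of (wlift v x) = type_of (wlift v' y)) ->
        (forall v, exists v', type_of (wlift v y) = type_of (wlift v' x)) ->
        type_of (r x) = type_of (r y)].
Proof.
have /choice [cp cpP] : forall T : set (set probe), exists p, T !=set0 -> T p.
  move=> T; have [[p Tp]|nT] := pselect (T !=set0); first by exists p.
  by exists setT.
pose types (x : X) : set (set probe) := [set p | exists v, p = type_of (wlift v x)].
have [[x0]|nX] := pselect (inhabited X); last first.
  have absurd (x : X) : False by apply: nX; split; exact: x.
  by exists id; split=> [x|w x|x]; case: (absurd x).
have /choice [cr crP] : forall O : set X, exists x, O !=set0 -> O x.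
  move=> O; have [[x Ox]|nO] := pselect (O !=set0); first by exists x.
  by exists x0.
have types_wlift w x : types (wlift w x) = types x.
  rewrite eqEsubset; split=> p [v ->]; first by exists (v ++ w); rewrite wlift_cat.
  by exists (v ++ rev w); rewrite wlift_cat (wlift_rev sK).
pose r x := cr (orbit s x `&` [set y | type_of y = cp (types x)]).
have rP x : (orbit s x `&` [set y | type_of y = cp (types x)]) (r x).
  apply: crP; have [|v vP] := cpP (types x).
    by exists (type_of (wlift [::] x)), [::].
  by exists (wlift v x); split; [exists v|rewrite /= vP].
exists r; split=> [x|w x|x y xy yx]; first by case: (rP x).
  by rewrite /r types_wlift (orbit_wlift sK).
have -> := (rP x).2; have -> := (rP y).2; congr cp.
rewrite eqEsubset; split=> p [v ->].
  by have [v' ->] := xy v; exists v'.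
by have [v' ->] := yx v; exists v'.
Qed.

(** The orbit of a non-standard [x] with root [r x] goes to the orbit of a point
    of [Y] that has the type of [r x], the one labelled by [j (r x)].  If the
    images of two orbits meet, they are equal; then the same types occur in the
    two orbits, so the roots have the same type, hence the same label. *)
Lemma equivariant_embedding (X Y : extension A) (j : X -> Y) :
  injective j -> rich s Y -> exists2 e : X -> Y, injective e & morphism e.
Proof.
move=> j_inj /independent_realizations [d dP].
have [r [rO r_wlift r_type]] := canonical_roots X.
have /choice [wd wdP] : forall x, exists w, x = wlift w (r x).
  move=> x; have [w rx] := rO x; exists (rev w).
  by rewrite rx (wlift_rev sK).
have nonstd_r x : nonstd x -> nonstd (r x).
  by have [w ->] := rO x => nx; apply: (nonstd_wlift sK).
pose img x := d (type_of (r x)) (j (r x)).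
have imgP x : nonstd x -> nonstd (img x) /\ type_of (img x) = type_of (r x).
  by move=> /nonstd_r /dP [d1 d2 _]; split; [apply: d1|apply: d2].
(* [r x] and [img x] have the same stabilizer, which is part of the type; so the
   bijection between their orbits is well defined and injective. *)
have img_wlift x v w : nonstd x -> wlift v (r x) = wlift w (r x) <->
    wlift v (img x) = wlift w (img x).
  move=> nx; have tx : type_of (img x) = type_of (r x) by case: (imgP x nx).
  have fixE (Z : extension A) (z : Z) :
      wlift v z = wlift w z <-> wlift (rev w ++ v) z = z.
    rewrite wlift_cat; split; first by move=> ->; rewrite (wlift_rev sK).
    by move=> {2}<-; rewrite (wlift_revr sK).
  by rewrite !fixE -!type_of_fix tx.
have /choice [e eP] : forall x, exists y, (forall a, x = std X a -> y = std Y a) /\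
    (nonstd x -> forall w, x = wlift w (r x) -> y = wlift w (img x)).
  move=> x; have [[a xa]|nsx] := std_or_nonstd x.
    exists (std Y a); split; last by move=> /(_ a).
    by move=> b; rewrite xa => /(@std_inj _ X) <-.
  exists (wlift (wd x) (img x)); split; first by move=> a /nsx.
  by move=> _ w xw; apply/(img_wlift x) => //; rewrite -wdP.
have e_std a : e (std X a) = std Y a by apply: (eP _).1.
have e_nonstd x : nonstd x -> nonstd (e x).
  move=> nx; rewrite ((eP x).2 nx _ (wdP x)).
  by apply: (nonstd_wlift sK); case: (imgP x nx).
exists e; last split=> //.
- move=> x y exy.
  have [[a xa]|nsx] := std_or_nonstd x.
    have [[b yb]|nsy] := std_or_nonstd y.
      by move: exy; rewrite xa yb !e_std => /(@std_inj _ Y) ->.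
    by have /(_ a) := e_nonstd y nsy; rewrite -exy xa e_std.
  have nsy : nonstd y.
    move=> b yb; apply: (e_nonstd x nsx b).
    by rewrite exy yb e_std.
  have := exy; rewrite ((eP x).2 nsx _ (wdP x)) ((eP y).2 nsy _ (wdP y)) => im.
  have rxy : type_of (r x) = type_of (r y).
    (* A common point of the two image orbits carries every type of the one orbit
       to the other. *)
    have trans (x' y' : X) w w' : nonstd x' -> nonstd y' ->
        wlift w (img x') = wlift w' (img y') ->
        forall v, exists v', type_of (wlift v (r x')) = type_of (wlift v' (r y')).
      move=> nx' ny' im' v; exists (v ++ rev w ++ w').
      rewrite !type_of_wlift -(imgP y' ny').2 -(imgP x' nx').2 -!type_of_wlift.
      by rewrite !wlift_cat -im' (wlift_rev sK).
    have r_idem x' : type_of (r (r x')) = type_of (r x').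
      by congr type_of; rewrite {2}(wdP x') r_wlift.
    rewrite -(r_idem x) -(r_idem y); apply: r_type.
      exact: (trans _ _ (wd x) (wd y)).
    by apply: (trans _ _ (wd y) (wd x)).
  have [_ _ indep] := dP _ _ (nonstd_r x nsx).
  have r_eq : r x = r y.
    apply: j_inj; apply: (indep (rev (wd y) ++ wd x)).
    by rewrite wlift_cat im (wlift_rev sK) /img rxy.
  rewrite (wdP x) (wdP y) -r_eq; apply/img_wlift => //.
  by rewrite im /img r_eq.
- move=> k x; have [[a xa]|nsx] := std_or_nonstd x.
    by rewrite xa e_std !lift_std e_std.
  rewrite -!wlift1 ((eP x).2 nsx _ (wdP x)) -wlift_cat.
  have -> : img x = img (wlift [:: k] x) by rewrite /img r_wlift.
  apply: (eP _).2; first exact: (nonstd_wlift sK).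
  by rewrite r_wlift wlift_cat -wdP.
- move=> l x; have [[a xa]|nsx] := std_or_nonstd x.
    have std_pred (Z : extension A) : uf (std Z a) (P l) <-> P l a.
      split=> [Pl|Pla]; last first.
        by apply: (@filterS _ _ (uf_filter (std Z a))) (uf_std Z a) => b ->.
      by have [b [Pb <-]] := filter_meet (uf_filter (std Z a)) Pl (uf_std Z a).
    by rewrite xa e_std !std_pred.
  rewrite -!type_of_pred ((eP x).2 nsx _ (wdP x)) type_of_wlift (imgP x nsx).2.
  by rewrite -type_of_wlift -wdP.
Qed.

(** * Bijections from mutual embeddings *)

(** The Schroeder-Bernstein bijection has to be [f] on the points whose chain of
    preimages by [g], [f], [g], ... ends outside the range of [g]. *)
Inductive backtrack (X Y : Type) (f : X -> Y) (g : Y -> X) : X -> Prop :=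
| Backtrack_start x : (forall y, x <> g y) -> backtrack f g x
| Backtrack_step x : backtrack f g x -> backtrack f g (g (f x)).

Lemma schroeder_bernstein_explicit (X Y : Type) (f : X -> Y) (g : Y -> X) :
  injective f -> injective g -> exists h : X -> Y, [/\ bijective h,
    forall x, backtrack f g x -> h x = f x &
    forall x, ~ backtrack f g x -> g (h x) = x].
Proof.
move=> f_inj g_inj.
have /choice [h hP] : forall x, exists y, (backtrack f g x -> y = f x) /\
    (~ backtrack f g x -> g y = x).
  move=> x; have [bx|nbx] := pselect (backtrack f g x).
    by exists (f x); split=> // /(_ bx).
  have [[y xy]|ny] := pselect (exists y, x = g y).
    by exists y; split=> // /nbx.
  by case: nbx; left=> y xy; apply: ny; exists y.
have h1 x := (hP x).1; have h2 x := (hP x).2.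
exists h; split=> //.
have h_inj : injective h.
  have key x y : backtrack f g x -> ~ backtrack f g y -> h x <> h y.
    move=> bx nby hxy; apply: (nby); rewrite -(h2 _ nby) -hxy h1 //.
    exact: Backtrack_step.
  move=> x y hxy.
  have [bx|nbx] := pselect (backtrack f g x);
    have [cy|ncy] := pselect (backtrack f g y).
  - by apply: f_inj; rewrite -!h1.
  - by case: (key x y).
  - by case: (key y x).
  - by rewrite -(h2 x) // hxy h2.
have /choice [h' h'K] : forall y, exists x, h x = y.
  move=> y; have [bgy|nbgy] := pselect (backtrack f g (g y)); last first.
    by exists (g y); apply: g_inj; rewrite h2.
  have [x bx gfx] : exists2 x, backtrack f g x & g (f x) = g y.
    move: bgy; move E : (g y) => z bz; case: bz E => [{}z nz E|x bx E].
      by case: (nz y).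
    by exists x.
  by exists x; rewrite h1 //; apply: g_inj.
by exists h' => // x; apply: h_inj; rewrite h'K.
Qed.

(** [backtrack f g] is invariant under the involutions, because the range of [g]
    and hence its complement are. *)
Lemma mutual_morphisms_bijective (X Y : extension A) (f : X -> Y) (g : Y -> X) :
  injective f -> injective g -> morphism f -> morphism g ->
  exists2 h : X -> Y, bijective h & morphism h.
Proof.
move=> f_inj g_inj [f_std f_lift f_pred] [g_std g_lift g_pred].
have [h [h_bij h1 h2]] := schroeder_bernstein_explicit f_inj g_inj.
have lift_inv (Z : extension A) k (z : Z) : lift (s k) (lift (s k) z) = z.
  by rewrite lift_comp; apply: lift_eqid; apply: sK.
have b_lift k x : backtrack f g x -> backtrack f g (lift (s k) x).
  elim=> {x} [x nx|x _ bx]; last by rewrite -g_lift -f_lift; right.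
  by left=> y xy; apply: (nx (lift (s k) y)); rewrite g_lift -xy lift_inv.
have bE k x : backtrack f g (lift (s k) x) <-> backtrack f g x.
  by split; [rewrite -{2}(lift_inv _ k x)|]; apply: b_lift.
exists h => //; split=> [a|k x|l x].
- have [b|nb] := pselect (backtrack f g (std X a)); first by rewrite h1 ?f_std.
  by apply: g_inj; rewrite h2 ?g_std.
- have [b|nb] := pselect (backtrack f g x); first by rewrite !h1 ?bE ?f_lift.
  by apply: g_inj; rewrite g_lift !h2 ?bE.
- have [b|nb] := pselect (backtrack f g x); first by rewrite h1 ?f_pred.
  by rewrite -{2}(h2 x) ?g_pred.
Qed.

Lemma rich_extensions_isomorphic (X Y : extension A) :
  rich s X -> rich s Y -> [set: X] #= [set: Y] ->
  exists2 h : X -> Y, bijective h & morphism h.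
Proof.
move=> richX richY; rewrite card_eq_le => /andP[].
move=> /card_leTT_inj [i i_inj] /card_leTT_inj [j j_inj].
have [f f_inj fM] := equivariant_embedding i_inj richY.
have [g g_inj gM] := equivariant_embedding j_inj richX.
exact: mutual_morphisms_bijective fM gM.
Qed.

End Embedding.

(** * Sparse sequences *)

Section Sparse.
Variables (A : Type) (K : finType) (s : K -> A -> A).
Hypothesis sK : forall k, involutive (s k).

(** Each new term avoids the finitely many points that words of small code
    connect to an earlier term.  A constant [depth] is used for ultrapowers and
    the identity for ultrafilter extensions. *)
Lemma sparse_sequence (S : nat -> set A) (depth : nat -> nat) :
  (forall n, inexhaustible (S n)) ->
  exists t : nat -> A, (forall m, S m (t m)) /\
    forall m m' w, pickle w < depth m -> pickle w < depth m' ->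
      act s w (t m) = t m' -> m = m'.
Proof.
move=> infS.
have /choice [next nextP] : forall mh : nat * (nat -> A), exists a,
    S mh.1 a /\ forall i w, i < mh.1 -> pickle w < depth mh.1 ->
      a <> act s w (mh.2 i) /\ mh.2 i <> act s w a.
  move=> [m h].
  (* Words range over their codes [c]; a [c] that codes no word gets an arbitrary
     point to avoid. *)
  pose avoid (p : 'I_m * 'I_(depth m) * bool) := let: (i, c, b) := p in
    if @pickle_inv (seq K) c is Some w then act s (if b then w else rev w) (h i)
    else h i.
  have [a Sa avoid_a] := infS m _ avoid.
  exists a; split=> // i w im wm.
  have avoid_w b : avoid (Ordinal im, Ordinal wm, b) =
    act s (if b then w else rev w) (h i) by rewrite /avoid /= pickleK_inv.
  split=> [aw|/= hi].
    by apply: (avoid_a (Ordinal im, Ordinal wm, true)); rewrite avoid_w.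
  by apply: (avoid_a (Ordinal im, Ordinal wm, false)); rewrite avoid_w hi act_rev.
have [a0 _ _] := infS 0 void (fun k => match k with end).
pose hist := fix hist m := if m is m'.+1 then
  fun i => if i == m' then next (m', hist m') else hist m' i
  else fun=> a0.
pose t m := next (m, hist m).
have histE m i : i < m -> hist m i = t i.
  elim: m => // m IH; rewrite ltnS leq_eqVlt => /orP[/eqP ->|im] /=.
    by rewrite eqxx.
  by rewrite ltn_eqF // IH.
exists t; split=> [m|m m' w wm wm' wt]; first by have [] := nextP (m, hist m).
have [lt|lt|//] := ltngtP m m'.
  have [_ /(_ m w lt wm') [/= + _]] := nextP (m', hist m').
  by rewrite histE // wt.
have [_ /(_ m' w lt wm) [/= _]] := nextP (m, hist m).
by rewrite histE // wt.
Qed.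

End Sparse.

(** * Ultrapowers as extensions *)

Section Ultrapower.
Variables (A I : Type) (D : set_system I).
Hypothesis D_ultra : UltraFilter D.

Definition ucls (f : I -> A) : ultrapower_carrier A D :=
  exist _ (ae_class D f) (ex_intro _ f erefl).

Definition urep (C : ultrapower_carrier A D) : I -> A := sval (cid (svalP C)).

Lemma urepK C : ucls (urep C) = C.
Proof.
rewrite /ucls /urep; case: cid => f /= Cf.
by case: C Cf => C hC /= Cf; apply: eq_exist.
Qed.

Lemma uclsP f g : ucls f = ucls g <-> D [set i | f i = g i].
Proof.
split=> [[fg]|fg].
  suff : ae_class D f g by [].
  by rewrite fg; apply: filterS filterT.
apply: eq_exist; rewrite eqEsubset; split=> h /= hf.
  by apply: filterS (filterI fg hf) => i [/= <-].
by apply: filterS (filterI fg hf) => i [/= ->].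
Qed.

Lemma urep_ae f : D [set i | urep (ucls f) i = f i].
Proof. by apply/uclsP; rewrite urepK. Qed.

Lemma mem_ucls (C : ultrapower_carrier A D) f : sval C f <-> C = ucls f.
Proof. by rewrite -{1 2}(urepK C) uclsP. Qed.

Lemma uf_ucls f : urep (ucls f) @ D = f @ D.
Proof.
apply: ultra_sub_eq; [exact: ultra_fmap|exact: ultra_fmap|] => S FS.
have {}FS : D (urep (ucls f) @^-1` S) by [].
change (D (f @^-1` S)).
by apply: filterS (filterI FS (urep_ae f)) => i [/= + <-].
Qed.

Definition ultrapower_extension : extension A.
refine (@Extension A (ultrapower_carrier A D) (fun C => urep C @ D)
  (fun h C => ucls (h \o urep C)) (fun a => ucls (fun=> a)) _ _ _ _ _ _ _).
- by move=> C; apply: ultra_fmap.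
- by move=> f C S; rewrite uf_ucls.
- move=> f g C; apply/uclsP; apply: filterS (urep_ae (g \o urep C)) => i /= ->.
  by [].
- by move=> f C CS; rewrite -[RHS]urepK; apply/uclsP; exact: CS.
- by move=> f C _; rewrite -[RHS]urepK => /uclsP fC; exact: fC.
- by [].
- by move=> a; rewrite uf_ucls; apply: (@filterS I D _ setT) filterT => i _.
Defined.

End Ultrapower.

(** Enumerate infinitely many members [g n] of a regularizing family and let
    [nu i] bound the finitely many [n] such that [i] is in [g n]. *)
Lemma regular_exhaustion (I : Type) (D : set_system I) :
  regular_ultrafilter D -> exists nu : I -> nat, forall n, D [set i | n < nu i].
Proof.
case=> infI D_ultra [E [ED EI Efin]].
have [g gE g_inj] : exists2 g : nat -> set I, forall n, E (g n) & injective g.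
  have : [set: nat] #<= E.
    apply: card_le_trans (proj1 (infiniteP _) infI) _.
    by move: EI; rewrite card_eq_le => /andP[].
  case/card_le_inj=> g [gE g_inj].
  by exists (fun n => g n Logic.I) => [n|m n /g_inj]; first exact: gE.
have /choice [nu nuP] : forall i, exists m, forall n, g n i -> n < m.
  move=> i; have [K [v vP]] := finite_set_cover (Efin i).
  have /choice [c cP] : forall k, exists m, forall n, g n = v k -> n = m.
    move=> k; have [[m gm]|nm] := pselect (exists m, g m = v k).
      by exists m => n gn; apply: g_inj; rewrite gn.
    by exists 0 => n gn; case: nm; exists n.
  exists (\max_k c k).+1 => n gni; have [k gk] := vP (g n) (conj (gE n) gni).
  by rewrite ltnS (cP k n gk) leq_bigmax.
exists nu => n; apply: filterS (ED _ (gE n)) => i; exact: nuP.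
Qed.

Section Richness.
Variables (A : Type) (iota : A -> nat).
Hypothesis iota_inj : injective iota.
Variables (K : finType) (s : K -> A -> A).
Hypothesis sK : forall k, involutive (s k).

(** Coordinate [i] uses a sequence that is sparse up to depth [nu i]; as [nu]
    exceeds every integer almost everywhere, no word relates the images of two
    distinct classes. *)
Lemma ultrapower_rich (I : Type) (D : set_system I) (D_ultra : UltraFilter D)
    (nu : I -> nat) : (forall n, D [set i | n < nu i]) ->
  rich s (ultrapower_extension A D_ultra).
Proof.
move=> nuP S infS decS.
have /choice [t tP] : forall n, exists t : nat -> A, (forall m, S n (t m)) /\
    forall m m' w, pickle w < n -> act s w (t m) = t m' -> m = m'.
  move=> n; have [t [tS t_sparse]] :=
    @sparse_sequence _ _ _ sK (fun=> S n) (fun=> n) (fun=> infS n).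
  by exists t; split=> // m m' w wn; apply: t_sparse.
exists (fun C => ucls D (fun i => t (nu i) (iota (urep C i)))); split=> [C n|w C C'].
  change ((urep (ucls D (fun i => t (nu i) (iota (urep C i)))) @ D) (S n)).
  rewrite uf_ucls; change (D [set i | S n (t (nu i) (iota (urep C i)))]).
  apply: filterS (nuP n) => i /= ni.
  exact: (decS _ _ (ltnW ni) _ ((tP _).1 _)).
move=> /uclsP wCC'; rewrite -(urepK C) -(urepK C'); apply/uclsP.
have := urep_ae D_ultra (fun i => t (nu i) (iota (urep C i))).
move=> /(filterI wCC') /(filterI (nuP (pickle w))).
apply: filterS => i [/= wi [/= + ur]]; rewrite ur.
by move=> /((tP (nu i)).2 _ _ _ wi) /iota_inj.
Qed.

End Richness.

(** * Ultrafilter extensions *)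

Definition principal (A : Type) (a : A) : ultrafilter A :=
  exist _ (principal_filter a) (principal_filter_ultra a).

Definition push (A : Type) (f : A -> A) (u : ultrafilter A) : ultrafilter A :=
  exist _ (f @ sval u) (ultra_fmap f (svalP u)).

Lemma ultrafilter_ext (A : Type) (u v : ultrafilter A) : sval u `<=` sval v -> u = v.
Proof.
case: u v => u Hu [v Hv] /= uv; apply: eq_exist; exact: ultra_sub_eq uv.
Qed.

Definition ue_extension (A : Type) (A_countable : countable [set: A]) : extension A.
refine (@Extension A (ultrafilter A) sval (@push A) (@principal A) _ _ _ _ _ _ _).
- by move=> [].
- by [].
- by move=> f g u; apply: ultrafilter_ext => S.
- move=> f [u u_ultra] fu; apply: ultrafilter_ext => S /= Su.
  have {}Su : u (f @^-1` S) by [].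
  by apply: filterS (filterI fu Su) => a [/= fa]; rewrite /preimage /= fa.
- by move=> f [u u_ultra] f_inj [fu]; apply: ultra_fixpoint.
- move=> a [u u_ultra]; apply/esym/ultrafilter_ext => S /principal_filterP Sa.
  by change (u ((fun=> a) @^-1` S)); apply: filterS filterT.
- by move=> a; apply/principal_filterP.
Defined.

Lemma nonprincipal_nat : exists2 F : set_system nat,
  UltraFilter F & forall n, F [set m | n < m].
Proof.
have [F [F_ultra oF]] := ultraFilterLemma eventually_filter.
by exists F => // n; apply: oF; exists n.+1.
Qed.

Definition tensor (A T : Type) (u : set_system A) (w : set_system nat)
    (f : A -> nat -> T) : set_system T :=
  [set S | u [set a | w [set k | S (f a k)]]].

Lemma tensor_ultra (A T : Type) (u : set_system A) (w : set_system nat)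
    (f : A -> nat -> T) : UltraFilter u -> UltraFilter w ->
  UltraFilter (tensor u w f).
Proof.
move=> Hu Hw; apply: build_ultra.
  apply: Build_ProperFilter.
    rewrite /tensor /= => u0.
    have [a [wa _]] := filter_meet (@ultra_proper _ _ Hu) u0 u0.
    by have [k []] := filter_meet (@ultra_proper _ _ Hw) wa wa.
  split=> [|S S' uS uS'|S S' SS' uS].
  - change (u [set a | w setT]); apply: filterS filterT => a _; exact: filterT.
  - change (u [set a | w [set k | S (f a k)] ]) in uS.
    change (u [set a | w [set k | S' (f a k)] ]) in uS'.
    change (u [set a | w [set k | (S `&` S') (f a k)] ]).
    apply: filterS (filterI uS uS') => a [wS wS'].
    exact: filterI wS wS'.
  - change (u [set a | w [set k | S (f a k)] ]) in uS.
    change (u [set a | w [set k | S' (f a k)] ]).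
    by apply: filterS uS => a; apply: filterS => k; apply: SS'.
move=> S; have [|uC] := in_ultra_setVsetC [set a | w [set k | S (f a k)] ] Hu.
  by left.
right; change (u [set a | w [set k | ~ S (f a k)] ]); apply: filterS uC => a.
by move/(@ultra_setC _ _ [set k | S (f a k)] Hw).
Qed.

Section UeRichness.
Variables (A : Type) (A_countable : countable [set: A]).
Variables (iota : A -> nat).
Hypothesis iota_inj : injective iota.
Variables (K : finType) (s : K -> A -> A).
Hypothesis sK : forall k, involutive (s k).

(** The ultrafilter [d u] is spread along [t] by a tensor product whose second
    factor makes it non-principal and whose first factor [u] can be recovered:
    if [U] is in [u] but not in [v], then [d u] contains the set of late terms of
    [t] with first coordinate in [U], and [d v] the set of those with first
    coordinate outside [U]; sparsity prevents the word [w] from relating these. *)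
Lemma ue_rich : rich s (ue_extension A_countable).
Proof.
move=> S infS decS.
have [t [tS t_sparse]] := sparse_sequence sK id infS.
have [F F_ultra F_np] := nonprincipal_nat.
pose code a (k : nat) := pickle (iota a, k).
have code_inj a k a' k' : code a k = code a' k' -> a = a'.
  by move=> /(pcan_inj (@pickleK (nat * nat)%type)) [/iota_inj].
have F_code a n : F [set k | n < code a k].
  (* Finitely many [k] have a code that is at most [n]. *)
  pose bad (c : 'I_n.+1) :=
    if @pickle_inv (nat * nat)%type c is Some p then p.2 else 0.
  apply: filterS (F_np (\max_c bad c)) => k /= bk; rewrite ltnNge; apply/negP => cn.
  move: bk; rewrite ltnNge => /negP; apply.
  have -> : k = bad (Ordinal (cn : code a k < n.+1)) by rewrite /bad /= pickleK_inv.
  exact: leq_bigmax.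
pose d (u : ultrafilter A) : ultrafilter A :=
  exist _ (tensor (sval u) F (fun a k => t (code a k)))
    (tensor_ultra _ (svalP u) F_ultra).
exists d; split=> [[u u_ultra] n|w [u u_ultra] [v v_ultra] wuv].
  change (u [set a | F [set k | S n (t (code a k))] ]).
  apply: filterS filterT => a _; apply: filterS (F_code a n) => k /= /ltnW nk.
  exact: decS (tS _).
apply: ultrafilter_ext => U /= uU.
apply: contrapT => /(@ultra_setC _ _ _ v_ultra) vU.
pose far a k := pickle w < code a k.
have : sval (@wlift _ _ s (ue_extension A_countable) w (d (exist _ u u_ultra)))
    [set b | exists a k, [/\ U a, far a k & b = act s w (t (code a k))]].
  change (u [set a0 | F [set k0 | exists a k,
    [/\ U a, far a k & act s w (t (code a0 k0)) = act s w (t (code a k))] ] ]).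
  apply: filterS uU => a Ua; apply: filterS (F_code a (pickle w)) => k ak.
  by exists a, k.
rewrite wuv => dv.
have {}dv : v [set a | F [set k | exists a' k',
    [/\ U a', far a' k' & t (code a k) = act s w (t (code a' k'))] ] ] by [].
have [a [nUa Fa]] := filter_meet (@ultra_proper _ _ v_ultra) vU dv.
have [k [ak [a' [k' [Ua' fk' tt]]]]] :=
  filter_meet (@ultra_proper _ _ F_ultra) (F_code a (pickle w)) Fa.
by have /code_inj aa := t_sparse _ _ _ fk' ak (esym tt); apply: nUa; rewrite -aa.
Qed.

End UeRichness.

(** * Almost bounded graphs as finite unions of involutions and constants *)

Lemma matching_involution (T : Type) (m : T -> T -> Prop) :
  (forall x y, m x y -> m y x) -> (forall x y z, m x y -> m x z -> y = z) ->
  exists2 g : T -> T, involutive g & forall x y, m x y -> y = g x.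
Proof.
move=> m_sym m_fun.
have /choice [g gP] : forall x, exists y, m x y \/ y = x /\ forall z, ~ m x z.
  move=> x; have [[y xy]|nx] := pselect (exists y, m x y); first by exists y; left.
  by exists x; right; split=> // z xz; apply: nx; exists z.
exists g => [x|x y xy]; last first.
  by case: (gP x) => [xg|[_ /(_ y)]//]; apply: m_fun xy xg.
case: (gP x) => [xg|[gx _]]; last by rewrite gx gx.
case: (gP (g x)) => [gg|[_ /(_ x) []]]; last exact: m_sym.
by apply: m_fun gg _; apply: m_sym.
Qed.

(** An edge at a node of infinite degree is covered by the constant function with
    that node as value.  The other nodes span a graph of bounded degree; with a
    colouring in which distinct neighbours of a node have distinct colours, the
    edges between two given colours form a matching, hence an involution. *)
Lemma almost_bounded_cover (S : structure) :
  countable [set: S] -> almost_bounded S ->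
  exists (K L : finType) (s : K -> S -> S) (c : L -> S),
    (forall k, involutive (s k)) /\
    forall a b, edge a b -> (exists k, b = s k a) \/ exists l, a = c l \/ b = c l.
Proof.
move=> /card_leTT_inj [iota iota_inj] [inf_fin [n deg_n]].
have [L [c cP]] := finite_set_cover inf_fin.
have /choice [nbr nbrP] : forall x : S, exists nbr : 'I_n * bool -> S,
    ~ infinite_degree x -> forall y, edge x y \/ edge y x -> exists p, y = nbr p.
  move=> x; have [nx|ix] := pselect (infinite_degree x); first by exists (fun=> x).
  have [succ_n pred_n] := deg_n x ix.
  have [v vP] := card_le_cover x succ_n; have [w wP] := card_le_cover x pred_n.
  exists (fun p => if p.2 then v p.1 else w p.1) => _ y [/vP|/wP] [k ->].
    by exists (k, true).
  by exists (k, false).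
pose adj (x y : S) :=
  [/\ ~ infinite_degree x, ~ infinite_degree y & edge x y \/ edge y x].
have adj_sym x y : adj x y -> adj y x by case=> nx ny /or_comm xy; split.
have adj_nbr x y : adj x y -> exists p, y = nbr x p.
  by case=> nx _; apply: nbrP.
pose Q : finType := (('I_n * bool) * ('I_n * bool))%type.
have [col colP] := greedy_coloring (K := Q)
  (fun p x => nbr (nbr x p.1) p.2) iota_inj.
have col_adj z x y : adj z x -> adj z y -> col x = col y -> x = y.
  move=> zx zy xy; apply: contrapT => nxy; apply: colP xy => //.
    have [p def_z] := adj_nbr _ _ (adj_sym _ _ zx); have [q ->] := adj_nbr _ _ zy.
    by exists (p, q); rewrite /= -def_z.
  have [p def_z] := adj_nbr _ _ (adj_sym _ _ zy); have [q ->] := adj_nbr _ _ zx.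
  by exists (p, q); rewrite /= -def_z.
pose C : finType := 'I_#|Q|.+1.
have /choice [s sP] : forall k : C * C, exists g : S -> S, involutive g /\
    forall x y, adj x y -> (col x, col y) = k \/ (col y, col x) = k -> y = g x.
  move=> k; have [||g gK gP] := @matching_involution _
    (fun x y => adj x y /\ ((col x, col y) = k \/ (col y, col x) = k)).
  - by move=> x y [/adj_sym xy /or_comm].
  - move=> x y z [xy kxy] [xz kxz]; apply: col_adj xy xz _.
    by move: kxz; case: kxy => <- [] []; congruence.
  - by exists g; split=> // x y xy kxy; apply: gP.
exists (C * C)%type, L, s, c; split=> [k|a b ab]; first by case: (sP k).
have [ia|na] := pselect (infinite_degree a).
  by have [l ->] := cP a ia; right; exists l; left.
have [ib|nb] := pselect (infinite_degree b).
  by have [l ->] := cP b ib; right; exists l; right.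
left; exists (col a, col b); apply: (sP _).2; last by left.
by split=> //; left.
Qed.

(** * Edges of the two extensions *)

Section Edges.
Variables (S : structure) (M : finType) (f : M -> S -> S).
Hypothesis f_cover : forall a b : S, edge a b -> exists m, b = f m a \/ a = f m b.

Definition forward (m : M) : set S := [set a | edge a (f m a)].
Definition backward (m : M) : set S := [set a | edge (f m a) a].

(** The relation that any extension inherits from the covering functions. *)
Definition lifted_edge (X : extension S) (x y : X) : Prop :=
  exists m, (y = lift (f m) x /\ uf x (forward m)) \/
            (x = lift (f m) y /\ uf y (backward m)).

Lemma ultrapower_edge_lifted (I : Type) (D : set_system I)
    (D_ultra : UltraFilter D) (x y : ultrapower S D) :
  edge x y <-> @lifted_edge (ultrapower_extension S D_ultra) x y.
Proof.
split.
  case=> g [h [/mem_ucls -> /mem_ucls -> gh]].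
  have [[m b] Dm] : exists mb : M * bool, D [set i | edge (g i) (h i) /\
      if mb.2 then h i = f mb.1 (g i) else g i = f mb.1 (h i)].
    apply: (ultra_exists D_ultra); apply: filterS gh => i /= ghi.
    have [m [hg|hg]] := f_cover ghi; first by exists (m, true).
    by exists (m, false).
  exists m; case: b Dm => Dm; [left|right]; split.
  - apply/uclsP; apply: filterS (filterI Dm (urep_ae D_ultra g)) => i [/= [_ hi] gi].
    by rewrite gi.
  - change ((urep (ucls D g) @ D) (forward m)); rewrite uf_ucls.
    change (D [set i | edge (g i) (f m (g i))]).
    by apply: filterS Dm => i [/= + hi]; rewrite hi.
  - apply/uclsP; apply: filterS (filterI Dm (urep_ae D_ultra h)) => i [/= [_ gi] hi].
    by rewrite hi.
  - change ((urep (ucls D h) @ D) (backward m)); rewrite uf_ucls.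
    change (D [set i | edge (f m (h i)) (h i)]).
    by apply: filterS Dm => i [/= + gi]; rewrite gi.
have rep (z : ultrapower S D) : sval z (urep z) by apply/mem_ucls; rewrite urepK.
case=> m [[-> xm]|[-> ym]].
  exists (urep x), (f m \o urep x); split=> //.
  exact/mem_ucls.
exists (f m \o urep y), (urep y); split=> //.
exact/mem_ucls.
Qed.

(** If [y] is not related to [x] through any of the covering functions, then for
    each of them some [Z] in the ultrafilter [x] has an image along that
    function outside the ultrafilter [y].  The intersection of these finitely
    many [Z] is in [x], but its image is a finite union of sets not in [y]. *)
Lemma ue_edge_lifted (S_countable : countable [set: S])
    (x y : ultrafilter_extension S) :
  edge x y <-> @lifted_edge (ue_extension S_countable) x y.
Proof.
split; last first.
  case: x y => [u u_ultra] [v v_ultra] [m [[-> um]|[-> vm]]] X /= uX.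
    change (u (f m @^-1` edge_image X)).
    by apply: filterS (filterI uX um) => a [Xa am]; exists a.
  have {}uX : v (f m @^-1` X) by [].
  by apply: filterS (filterI uX vm) => a [Xa am]; exists (f m a).
move=> xy; apply: contrapT => nxy.
have u_ultra := svalP x; have v_ultra := svalP y.
have /choice [Z ZP] : forall mb : M * bool, exists Z : set S, sval x Z /\
    ~ sval y [set b | exists2 a, Z a & edge a b /\
               if mb.2 then b = f mb.1 a else a = f mb.1 b].
  move=> [m []] /=.
    have [xm|nxm] := pselect (sval x (forward m)); last first.
      exists (~` forward m); split; first exact/ultra_setC.
      move=> y0; have [b [[a na [ab bfa]] _]] :=
        filter_meet (@ultra_proper _ _ v_ultra) y0 y0.
      by apply: na; rewrite /forward /= -bfa.
    have [|W yW nxW] := ultra_neq v_ultra (ultra_fmap (f m) u_ultra).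
      move=> yx; apply: nxy; exists m; left; split=> //.
      by apply: ultrafilter_ext; rewrite yx.
    exists (~` (f m @^-1` W)); split; first exact/ultra_setC.
    move=> y0; have [b [[a na [_ bfa]] Wb]] :=
      filter_meet (@ultra_proper _ _ v_ultra) y0 yW.
    by apply: na; rewrite /preimage /= -bfa.
  have [ym|nym] := pselect (sval y (backward m)); last first.
    exists setT; split; first exact: filterT.
    move=> y0; apply: nym; apply: filterS y0 => b [a _ [ab afb]].
    by rewrite /backward /= -afb.
  have [|W xW nyW] := ultra_neq u_ultra (ultra_fmap (f m) v_ultra).
    move=> yx; apply: nxy; exists m; right; split=> //.
    by apply: ultrafilter_ext; rewrite yx.
  exists W; split=> // y0; apply: nyW.
  change (sval y (f m @^-1` W)); apply: filterS y0 => b [a Wa [_ afb]].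
  by rewrite /preimage /= -afb.
have xZ : sval x [set a | forall mb, Z mb a].
  by apply: (@filter_forall S (M * bool)%type Z) => mb; case: (ZP mb).
have [mb] : exists mb, sval y [set b | exists2 a, Z mb a & edge a b /\
    if mb.2 then b = f mb.1 a else a = f mb.1 b].
  apply: (ultra_exists v_ultra); apply: filterS (xy _ xZ) => b [a Za ab].
  have [m [ba|ba]] := f_cover ab; first by exists (m, true), a.
  by exists (m, false), a.
by case: (ZP mb).
Qed.

End Edges.

Theorem corollary2p22 (A : structure)
    (A_countable : countable [set: A])
    (A_almost_bounded : almost_bounded A)
    (I : Type) (D : set_system I) (D_regular : regular_ultrafilter D)
    (card_ultrapower : [set: ultrapower A D] #= [set: ultrafilter A]) :
  isomorphic (ultrapower A D) (ultrafilter_extension A).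
Proof.
have [iota iota_inj] := card_leTT_inj A_countable.
have [K [L [s [c [sK s_cover]]]]] :=
  almost_bounded_cover A_countable A_almost_bounded.
pose f (m : K + L) := match m with inl k => s k | inr l => fun=> c l end.
have f_cover (a b : A) : edge a b -> exists m, b = f m a \/ a = f m b.
  move=> /s_cover [[k ->]|[l [->|->]]]; first by exists (inl k); left.
    by exists (inr l); right.
  by exists (inr l); left.
pose P (mb : (K + L) * bool) := if mb.2 then forward f mb.1 else backward f mb.1.
have D_ultra : UltraFilter D by case: D_regular.
have [nu nuP] := regular_exhaustion D_regular.
pose X := ultrapower_extension A D_ultra; pose Y := ue_extension A_countable.
have [h h_bij [h_std h_lift h_pred]] := rich_extensions_isomorphic iota_inj sK P
  (ultrapower_rich iota_inj sK D_ultra nuP : rich s X)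
  (ue_rich A_countable iota_inj sK : rich s Y) card_ultrapower.
have h_f m x : h (lift (f m) x) = lift (f m) (h x).
  by case: m => [k|l]; [exact: h_lift|rewrite /f !lift_cst h_std].
exists h; split=> // x y.
apply: iff_trans (ultrapower_edge_lifted f_cover D_ultra x y) _.
apply: iff_sym; apply: iff_trans (ue_edge_lifted f_cover A_countable (h x) (h y)) _.
have h_inj := bij_inj h_bij.
have predE m z : (uf (h z) (forward f m) <-> uf z (forward f m)) /\
    (uf (h z) (backward f m) <-> uf z (backward f m)).
  by split; [apply: (h_pred (m, true))|apply: (h_pred (m, false))].
split=> -[m [[e p]|[e p]]]; exists m; [left|right|left|right].
- by split; [apply: h_inj; rewrite h_f|apply/(predE m x).1].
- by split; [apply: h_inj; rewrite h_f|apply/(predE m y).2].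
- by split; [rewrite e h_f|apply/(predE m x).1].
- by split; [rewrite e h_f|apply/(predE m y).2].
Qed.
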